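(* Let $p>0$. The functionals $\|\cdot\|_p$ and $|\cdot|_p$ induce the same topology on the space $L_p=L^+_p(dt/2\pi)$; that is, the topology of the metric $\rho_p(f,g)=(\|f-g\|_p)^{\min\{p,1\}}$ coincides with the topology of the metric $|f-g|_p$. In other words, the norm convergence ($|f_n-f|_p\to0$) and the modular convergence ($\|f_n-f\|_p\to0$) are equivalent.
   Context: For $p>0$, $L_p=L^+_p(dt/2\pi)$ is the space of all (a.e.-equivalence classes of) complex-valued Lebesgue measurable functions $f$ on $[0,2\pi)$ with $$(\|f\|_p)^p:=\int_0^{2\pi}(\log(1+|f(t)|))^p\,\frac{dt}{2\pi}<\infty.$$ For $f\in L_p$, $$|f|_p=\inf\left\{\varepsilon>0:\int_0^{2\pi}\left(\log\left(1+\frac{|f(t)|}{\varepsilon}\right)\right)^p\frac{dt}{2\pi}\le\varepsilon\right\},$$ which is a complete $F$-norm on $L_p$. *)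

(* Defs.v *)
From HB Require Import structures.
From mathcomp Require Import all_boot all_order all_algebra.
From mathcomp Require Import all_classical all_reals all_analysis.
From mathcomp Require Import measurable_realfun generic_quotient ring_quotient complex.

Set Implicit Arguments.
Unset Strict Implicit.
Unset Printing Implicit Defensive.

Import Order.TTheory GRing.Theory Num.Theory numFieldNormedType.Exports.
Import ComplexField.Normc.

Local Open Scope classical_set_scope.
Local Open Scope ring_scope.
Local Open Scope quotient_scope.

Section real_lemmas.
Context {R : realType}.
Implicit Types a b p e : R.

Lemma ln1D_ge0 a : 0 <= a -> 0 <= ln (1 + a).
Proof. by move=> a0; rewrite ln_ge0// lerDl. Qed.

Lemma ler_ln1D a b : 0 <= a -> a <= b -> ln (1 + a) <= ln (1 + b).
Proof.
move=> a0 ab; have b0 := le_trans a0 ab.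
by rewrite ler_ln ?posrE ?lerD2l// ltr_pwDl.
Qed.

Lemma ln1D_subadd a b : 0 <= a -> 0 <= b ->
  ln (1 + (a + b)) <= ln (1 + a) + ln (1 + b).
Proof.
move=> a0 b0.
have a1 : 0 < 1 + a by rewrite ltr_pwDl.
have b1 : 0 < 1 + b by rewrite ltr_pwDl.
have ab1 : 0 < 1 + (a + b) by rewrite ltr_pwDl// addr_ge0.
rewrite -lnM ?posrE// ler_ln ?posrE ?mulr_gt0//.
by rewrite mulrDl mul1r mulrDr mulr1 [a + b]addrC addrA lerD2l lerDl mulr_ge0.
Qed.

Lemma powR_subadd a b p : 0 < p -> p <= 1 -> 0 <= a -> 0 <= b ->
  (a + b) `^ p <= a `^ p + b `^ p.
Proof.
move=> p0 p1 a0 b0; have [s0|s0] := leP (a + b) 0.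
  have -> : a + b = 0 by apply/eqP; rewrite eq_le s0 addr_ge0.
  by rewrite powR0 ?gt_eqF// addr_ge0// powR_ge0.
have H c : 0 <= c -> c <= a + b -> c / (a + b) * (a + b) `^ p <= c `^ p.
  move=> c0 cs; have [->|cn0] := eqVneq c 0; first by rewrite !mul0r powR_ge0.
  rewrite -[X in _ <= X `^ p](divfK (lt0r_neq0 s0)).
  rewrite powRM ?divr_ge0 ?(ltW s0)// ler_wpM2r ?powR_ge0//.
  by rewrite ger1_powR// ler_pdivrMr// mul1r cs andbT divr_gt0// lt0r cn0.
rewrite -[leLHS]mul1r -(divff (lt0r_neq0 s0)) mulrDl mulrDl.
by rewrite lerD// H// (lerDl, lerDr).
Qed.

Lemma powR_quasiadd a b p : 0 < p -> 0 <= a -> 0 <= b ->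
  (a + b) `^ p <= 2 `^ p * a `^ p + 2 `^ p * b `^ p.
Proof.
move=> p0 a0 b0; wlog ab : a b a0 b0 / a <= b.
  move=> W; have [/W|/ltW/W] := leP a b; first exact.
  by rewrite addrC [X in _ -> _ <= X]addrC; exact.
rewrite -(powRM p _ b0)// (@le_trans _ _ ((2 * b) `^ p))//.
  by rewrite ge0_ler_powR ?nnegrE ?(ltW p0) ?addr_ge0 ?mulr_ge0// mulr2n mulrDl
    mul1r lerD2r.
by rewrite lerDr mulr_ge0// powR_ge0.
Qed.

End real_lemmas.

Definition cabs (T : Type) (R : realType) (f : T -> R[i]) (t : T) : R :=
  normc (f t).

(* \int_D (log (1 + a))^p dmu. Like the two functionals below it is locked to
   keep unification from unfolding it. *)
HB.lock Definition log_integral d (T : measurableType d) (R : realType)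
    (mu : {measure set T -> \bar R}) (D : set T) (p : R) (a : T -> R) : \bar R :=
  \int[mu]_(t in D) (ln (1 + a t) `^ p)%:E.
Canonical log_integral_unlockable := Unlockable log_integral.unlock.

HB.lock Definition log_norm d (T : measurableType d) (R : realType)
    (mu : {measure set T -> \bar R}) (D : set T) (p : R) (f : T -> R[i]) : R :=
  fine (log_integral mu D p (cabs f)) `^ p^-1.
Canonical log_norm_unlockable := Unlockable log_norm.unlock.

(* For [f] with a finite [log_integral], the set below is nonempty and bounded
   from below, so that [inf] is its genuine infimum. *)
HB.lock Definition log_fnorm d (T : measurableType d) (R : realType)
    (mu : {measure set T -> \bar R}) (D : set T) (p : R) (f : T -> R[i]) : R :=
  inf [set e : R | 0 < e /\
    (log_integral mu D p (fun t => (cabs f t / e)%R) <= e%:E)%E].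
Canonical log_fnorm_unlockable := Unlockable log_fnorm.unlock.

Section log_integral.
Context d (T : measurableType d) (R : realType).
Variables (mu : {measure set T -> \bar R}) (D : set T).

Implicit Types (a b : T -> R) (f g : T -> R[i]).

Local Notation log_integral := (log_integral mu D).

Definition cmeasurable (f : T -> R[i]) :=
  measurable_fun D (fun t => complex.Re (f t)) /\ measurable_fun D (fun t => complex.Im (f t)).

Lemma cabs_ge0 f t : 0 <= cabs f t.
Proof. by rewrite /cabs; case: (f t) => a b; exact: sqrtr_ge0. Qed.

Lemma cabsD f g t : cabs (f + g) t <= cabs f t + cabs g t.
Proof. exact: (@le_normcD R (f t) (g t)). Qed.

Lemma cabsN f t : cabs (- f) t = cabs f t.
Proof. exact: (@normcN R (f t)). Qed.

Lemma measurable_cabs f : cmeasurable f -> measurable_fun D (cabs f).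
Proof.
case=> mr mi.
have -> : cabs f = fun t => (complex.Re (f t) ^+ 2 + complex.Im (f t) ^+ 2) `^ 2^-1.
  apply/funext => t; rewrite powR12_sqrt ?addr_ge0 ?sqr_ge0//.
  by rewrite /cabs; case: (f t).
apply: (measurableT_comp (measurable_powR _)).
by apply: measurable_funD; exact: measurable_funX.
Qed.

Lemma cmeasurableD f g : cmeasurable f -> cmeasurable g -> cmeasurable (f + g).
Proof.
move=> [f1 f2] [g1 g2]; split.
  rewrite (_ : (fun _ => _) = (fun t => complex.Re (f t)) \+ (fun t => complex.Re (g t))).
    exact: measurable_funD.
  by apply/funext => t /=; rewrite /GRing.add/=; case: (f t) (g t) => ? ? [? ?].
rewrite (_ : (fun _ => _) = (fun t => complex.Im (f t)) \+ (fun t => complex.Im (g t))).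
  exact: measurable_funD.
by apply/funext => t /=; rewrite /GRing.add/=; case: (f t) (g t) => ? ? [? ?].
Qed.

Lemma cmeasurableN f : cmeasurable f -> cmeasurable (- f).
Proof.
move=> [f1 f2]; split.
  rewrite (_ : (fun _ => _) = \- (fun t => complex.Re (f t))).
    exact: measurableT_comp.
  by apply/funext => t /=; rewrite /GRing.opp/=; case: (f t).
rewrite (_ : (fun _ => _) = \- (fun t => complex.Im (f t))).
  exact: measurableT_comp.
by apply/funext => t /=; rewrite /GRing.opp/=; case: (f t).
Qed.

Lemma cmeasurable0 : cmeasurable 0.
Proof. by split; exact: measurable_cst. Qed.

Hypothesis mD : measurable D.
Variable p : R.
Hypothesis p0 : 0 < p.

Lemma measurable_log_pow (a : T -> R) : measurable_fun D a ->
  measurable_fun D (fun t => (ln (1 + a t) `^ p)%:E).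
Proof.
move=> ma; apply/measurable_EFinP; apply: (measurableT_comp (measurable_powR _)).
by apply: (measurableT_comp (@measurable_ln R)); exact: measurable_funD.
Qed.

Lemma log_integral_ge0 a : (0 <= log_integral p a)%E.
Proof. by rewrite log_integral.unlock; apply: integral_ge0 => t _; rewrite lee_fin powR_ge0. Qed.

Lemma le_log_integral a b : measurable_fun D a -> measurable_fun D b ->
  (forall t, 0 <= a t) -> (forall t, a t <= b t) ->
  (log_integral p a <= log_integral p b)%E.
Proof.
move=> ma mb a0 ab; rewrite log_integral.unlock; apply: ge0_le_integral => //.
- by move=> t _; rewrite lee_fin powR_ge0.
- exact: measurable_log_pow.
- exact: measurable_log_pow.
- move=> t _; rewrite lee_fin ge0_ler_powR ?nnegrE ?(ltW p0)//.
  + exact: ln1D_ge0.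
  + by rewrite ln1D_ge0// (le_trans (a0 t)).
  + exact: ler_ln1D.
Qed.

Lemma log_integral0 : log_integral p (cst 0) = 0%E.
Proof.
rewrite log_integral.unlock; under eq_integral do rewrite addr0 ln1 powR0 ?gt_eqF//.
by rewrite integral0.
Qed.

Lemma ae_log_integral a b : measurable_fun D a -> measurable_fun D b ->
  {ae mu, forall t, D t -> a t = b t} -> log_integral p a = log_integral p b.
Proof.
move=> ma mb ab; rewrite log_integral.unlock; apply: ae_eq_integral => //; try exact: measurable_log_pow.
by apply: filterS ab => t /= h Dt; rewrite h.
Qed.

Lemma log_integral_eq0 a : measurable_fun D a -> (forall t, 0 <= a t) ->
  log_integral p a = 0%E -> {ae mu, forall t, D t -> a t = 0}.
Proof.
move=> ma a0; rewrite log_integral.unlock => h.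
have : ae_eq mu D (fun t => (ln (1 + a t) `^ p)%:E) (cst 0%E).
  apply/(ae_eq_integral_abs _ mD); first exact: measurable_log_pow.
  rewrite -[RHS]h; apply: eq_integral => t _.
  by rewrite gee0_abs// lee_fin powR_ge0.
apply: filterS => t /= /[apply] -[] /eqP; rewrite powR_eq0 => /andP[+ _].
rewrite ln_eq0 ?ltr_pwDl// => /eqP.
by rewrite -[X in _ = X]addr0 => /addrI.
Qed.

Lemma log_integral_quasiD a b : measurable_fun D a -> measurable_fun D b ->
  (forall t, 0 <= a t) -> (forall t, 0 <= b t) ->
  (log_integral p a < +oo)%E -> (log_integral p b < +oo)%E ->
  (log_integral p (a \+ b)%R < +oo)%E.
Proof.
rewrite log_integral.unlock => ma mb a0 b0 fa fb.
pose F (c : T -> R) t := ((2 `^ p)%:E * (ln (1 + c t) `^ p)%:E)%E.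
have mF (c : T -> R) : measurable_fun D c -> measurable_fun D (F c).
  move=> mc; apply: emeasurable_funM; first exact: measurable_cst.
  exact: measurable_log_pow.
have F0 (c : T -> R) t : (0 <= F c t)%E by rewrite mule_ge0// lee_fin powR_ge0.
have IF (c : T -> R) : measurable_fun D c ->
  (\int[mu]_(t in D) F c t = (2 `^ p)%:E * \int[mu]_(t in D) (ln (1 + c t) `^ p)%:E)%E.
  move=> mc; rewrite ge0_integralZl_EFin ?powR_ge0//.
    by move=> t _; rewrite lee_fin powR_ge0.
  exact: measurable_log_pow.
apply: (@le_lt_trans _ _ (\int[mu]_(t in D) (F a t + F b t))%E).
  apply: ge0_le_integral => //.
  - by move=> t _; rewrite lee_fin powR_ge0.
  - by apply: measurable_log_pow; exact: measurable_funD.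
  - by apply: emeasurable_funD; exact: mF.
  - move=> t _; rewrite lee_fin.
    apply: (le_trans _ (powR_quasiadd p0 (ln1D_ge0 (a0 t)) (ln1D_ge0 (b0 t)))).
    rewrite ge0_ler_powR ?nnegrE ?(ltW p0) ?addr_ge0 ?ln1D_ge0//.
      by rewrite addr_ge0.
    exact: ln1D_subadd.
rewrite ge0_integralD//; [|exact: mF..].
have Ify (c : T -> R) : measurable_fun D c ->
  (\int[mu]_(t in D) (ln (1 + c t) `^ p)%:E < +oo)%E ->
  (\int[mu]_(t in D) F c t < +oo)%E.
  by move=> mc fc; rewrite IF// lte_mul_pinfty// lee_fin powR_ge0.
by apply: lte_add_pinfty; [exact: Ify ma fa|exact: Ify mb fb].
Qed.

Local Notation log_norm := (log_norm mu D p).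
Local Notation log_fnorm := (log_fnorm mu D p).

Definition Lplus_pred (f : T -> R[i]) :=
  cmeasurable f /\ (log_integral p (cabs f) < +oo)%E.

Lemma ae_eq_cabs f g : {ae mu, forall t, D t -> f t = g t} ->
  {ae mu, forall t, D t -> cabs f t = cabs g t}.
Proof. by apply: filterS => t h Dt; rewrite /cabs h. Qed.

Lemma Lplus_fin f : Lplus_pred f ->
  (fine (log_integral p (cabs f)))%:E = log_integral p (cabs f).
Proof. by case=> _ If; rewrite fineK// ge0_fin_numE// log_integral_ge0. Qed.

Lemma Lplus_pred0 : Lplus_pred 0.
Proof.
split; first exact: cmeasurable0.
rewrite (_ : cabs 0 = cst 0) ?log_integral0 ?ltry//.
by apply/funext => t; exact: normc0.
Qed.

Lemma Lplus_predN f : Lplus_pred f -> Lplus_pred (- f).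
Proof.
move=> [mf If]; split; first exact: cmeasurableN.
by rewrite (_ : cabs (- f) = cabs f)//; apply/funext => t; exact: cabsN.
Qed.

Lemma Lplus_predD f g : Lplus_pred f -> Lplus_pred g -> Lplus_pred (f + g).
Proof.
move=> [mf If] [mg Ig]; split; first exact: cmeasurableD.
have := log_integral_quasiD (measurable_cabs mf) (measurable_cabs mg)
  (cabs_ge0 f) (cabs_ge0 g) If Ig.
apply: le_lt_trans; apply: le_log_integral.
- by apply: measurable_cabs; exact: cmeasurableD.
- by apply: measurable_funD; exact: measurable_cabs.
- exact: cabs_ge0.
- exact: cabsD.
Qed.

Lemma ae_log_norm f g : cmeasurable f -> cmeasurable g ->
  {ae mu, forall t, D t -> f t = g t} -> log_norm f = log_norm g.
Proof.
move=> mf mg /ae_eq_cabs fg; rewrite log_norm.unlock (@ae_log_integral (cabs f) (cabs g))//;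
  exact: measurable_cabs.
Qed.

Lemma log_norm_ge0 f : 0 <= log_norm f.
Proof. by rewrite log_norm.unlock powR_ge0. Qed.

Lemma log_normN f : log_norm (- f) = log_norm f.
Proof.
rewrite log_norm.unlock (_ : cabs (- f) = cabs f)//.
by apply/funext => t; exact: cabsN.
Qed.

Lemma log_norm0 : log_norm 0 = 0.
Proof.
rewrite log_norm.unlock (_ : cabs 0 = cst 0).
  by rewrite log_integral0 powR0// invr_neq0// gt_eqF.
by apply/funext => t; exact: normc0.
Qed.

Lemma log_norm_eq0 f : Lplus_pred f -> log_norm f = 0 ->
  {ae mu, forall t, D t -> f t = 0}.
Proof.
rewrite log_norm.unlock => Lf /powR_eq0_eq0 If0; have [mf _] := Lf.
have /log_integral_eq0 : log_integral p (cabs f) = 0%E.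
  by rewrite -(Lplus_fin Lf) If0.
move=> /(_ (measurable_cabs mf) (cabs_ge0 f)).
by apply: filterS => t /[apply]; exact: eq0_normc.
Qed.

Lemma log_normX f : Lplus_pred f ->
  log_norm f `^ p = fine (log_integral p (cabs f)).
Proof.
by move=> Lf; rewrite log_norm.unlock -powRrM mulVf ?gt_eqF// powRr1// fine_ge0//
  log_integral_ge0.
Qed.

Lemma log_normD_le1 f g : p <= 1 -> Lplus_pred f -> Lplus_pred g ->
  log_norm (f + g) `^ p <= log_norm f `^ p + log_norm g `^ p.
Proof.
move=> p1 Lf Lg; have Lfg := Lplus_predD Lf Lg.
rewrite (log_normX Lf) (log_normX Lg) (log_normX Lfg).
rewrite -lee_fin EFinD (Lplus_fin Lf) (Lplus_fin Lg) (Lplus_fin Lfg).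
have [[mf _] [mg _] [mfg _]] := And3 Lf Lg Lfg.
rewrite log_integral.unlock.
rewrite -ge0_integralD//; last 4 first.
- by move=> t _; rewrite lee_fin powR_ge0.
- by apply: measurable_log_pow; exact: measurable_cabs.
- by move=> t _; rewrite lee_fin powR_ge0.
- by apply: measurable_log_pow; exact: measurable_cabs.
apply: ge0_le_integral => //.
- by move=> t _; rewrite lee_fin powR_ge0.
- by apply: measurable_log_pow; exact: measurable_cabs.
- by apply: emeasurable_funD; apply: measurable_log_pow; exact: measurable_cabs.
- move=> t _; rewrite lee_fin.
  have h := powR_subadd p0 p1 (ln1D_ge0 (cabs_ge0 f t)) (ln1D_ge0 (cabs_ge0 g t)).
  apply: le_trans h; rewrite ge0_ler_powR ?nnegrE ?(ltW p0)//.
  + by rewrite ln1D_ge0// cabs_ge0.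
  + by rewrite addr_ge0// ln1D_ge0// cabs_ge0.
  + apply: (le_trans _ (ln1D_subadd (cabs_ge0 f t) (cabs_ge0 g t))).
    by rewrite ler_ln1D ?cabs_ge0 ?cabsD.
Qed.

Let lnrestr (f : T -> R[i]) := (fun t => ln (1 + cabs f t)) \_ D.

Let measurable_lnrestr f : cmeasurable f -> measurable_fun [set: T] (lnrestr f).
Proof.
move=> mf; apply/(measurable_restrictT _ mD).
apply: (measurableT_comp (@measurable_ln R)); apply: measurable_funD => //.
exact: measurable_cabs.
Qed.

Let Lnorm_lnrestr f :
  'N[mu]_p%:E[EFin \o lnrestr f]%E = (log_integral p (cabs f) `^ p^-1)%E.
Proof.
rewrite Lnorm.unlock log_integral.unlock [in RHS]integral_mkcond.
congr (_ `^ _)%E; apply: eq_integral => t _.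
rewrite /lnrestr /= /patch; case: ifPn => _.
  by rewrite ger0_norm// ln1D_ge0// cabs_ge0.
by rewrite normr0 powR0// gt_eqF.
Qed.

Let log_normE f : Lplus_pred f ->
  (log_norm f)%:E = 'N[mu]_p%:E[EFin \o lnrestr f]%E.
Proof.
by move=> Lf; rewrite Lnorm_lnrestr log_norm.unlock -poweR_EFin Lplus_fin.
Qed.

Lemma log_normD_ge1 f g : 1 <= p -> Lplus_pred f -> Lplus_pred g ->
  log_norm (f + g) <= log_norm f + log_norm g.
Proof.
move=> p1 Lf Lg; have Lfg := Lplus_predD Lf Lg.
have [[mf _] [mg _] [mfg _]] := And3 Lf Lg Lfg.
rewrite -lee_fin EFinD (log_normE Lf) (log_normE Lg) (log_normE Lfg).
apply: le_trans (minkowski_EFin _ (measurable_lnrestr mf)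
  (measurable_lnrestr mg) p1).
rewrite Lnorm.unlock; apply: gt0_ler_poweR.
- by rewrite invr_ge0 ltW.
- by rewrite in_itv/= leey andbT integral_ge0// => t _; exact: poweR_ge0.
- by rewrite in_itv/= leey andbT integral_ge0// => t _; exact: poweR_ge0.
apply: ge0_le_integral => //.
- by move=> t _; exact: poweR_ge0.
- apply/measurable_EFinP; apply: (measurableT_comp (measurable_powR _)).
  by apply: measurableT_comp => //; exact: measurable_lnrestr.
- apply/measurable_EFinP; apply: (measurableT_comp (measurable_powR _)).
  apply: measurableT_comp => //.
  by apply: measurable_funD; exact: measurable_lnrestr.
- move=> t _; rewrite lee_fin ge0_ler_powR ?nnegrE ?(ltW p0)//.
  rewrite /lnrestr /= /patch; case: ifPn => _; last by rewrite addr0.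
  rewrite !ger0_norm ?addr_ge0 ?ln1D_ge0 ?cabs_ge0//.
  apply: (le_trans _ (ln1D_subadd (cabs_ge0 f t) (cabs_ge0 g t))).
  by rewrite ler_ln1D ?cabs_ge0 ?cabsD.
Qed.

Lemma log_normD f g : Lplus_pred f -> Lplus_pred g ->
  log_norm (f + g) `^ Num.min p 1 <=
  log_norm f `^ Num.min p 1 + log_norm g `^ Num.min p 1.
Proof.
move=> Lf Lg; have [p1|/ltW p1] := leP p 1; first exact: log_normD_le1.
by rewrite !powRr1 ?log_norm_ge0//; exact: log_normD_ge1.
Qed.

Let fset f := [set e : R | 0 < e /\
  (log_integral p (fun t => (cabs f t / e)%R) <= e%:E)%E].

Let measurable_cabsV f e : cmeasurable f ->
  measurable_fun D (fun t => cabs f t / e).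
Proof. by move=> mf; apply: measurable_funM => //; exact: measurable_cabs. Qed.

Let infE f : inf (fset f) = log_fnorm f.
Proof. by rewrite log_fnorm.unlock. Qed.

Let fset_lbound f : lbound (fset f) 0.
Proof. by move=> e [/ltW]. Qed.

Let fset_has_lbound f : has_lbound (fset f).
Proof. by exists 0; exact: fset_lbound. Qed.

Let fset_nonempty f : Lplus_pred f -> fset f !=set0.
Proof.
move=> Lf; have [mf _] := Lf.
pose e := Num.max 1 (fine (log_integral p (cabs f))).
have e1 : 1 <= e by rewrite le_max lexx.
have e0 : 0 < e := lt_le_trans ltr01 e1.
exists e; split => //; apply: (@le_trans _ _ (log_integral p (cabs f))).
  apply: le_log_integral; [exact: measurable_cabsV|exact: measurable_cabs| |].
  - by move=> t; rewrite divr_ge0 ?cabs_ge0 ?(ltW e0).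
  - by move=> t; rewrite ler_pdivrMr// ler_peMr// cabs_ge0.
by rewrite -Lplus_fin// lee_fin le_max lexx orbT.
Qed.

Lemma log_fnorm_ge0 f : Lplus_pred f -> 0 <= log_fnorm f.
Proof.
move=> Lf; rewrite log_fnorm.unlock.
by apply: lb_le_inf; [exact: fset_nonempty|exact: fset_lbound].
Qed.

Lemma ae_log_fnorm f g : cmeasurable f -> cmeasurable g ->
  {ae mu, forall t, D t -> f t = g t} -> log_fnorm f = log_fnorm g.
Proof.
move=> mf mg /ae_eq_cabs fg; rewrite log_fnorm.unlock; congr inf.
apply/funext => e; apply/propext.
rewrite /= (@ae_log_integral _ (fun t => cabs g t / e))//.
- exact: measurable_cabsV.
- exact: measurable_cabsV.
- by apply: filterS fg => t h Dt; rewrite h.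
Qed.

Lemma log_fnormN f : log_fnorm (- f) = log_fnorm f.
Proof.
rewrite log_fnorm.unlock (_ : cabs (- f) = cabs f)//.
by apply/funext => t; exact: cabsN.
Qed.

Lemma log_fnorm0 : log_fnorm 0 = 0.
Proof.
apply/eqP; rewrite eq_le log_fnorm_ge0 ?andbT; last exact: Lplus_pred0.
apply/ler_addgt0Pl => e e0; rewrite addr0 log_fnorm.unlock; apply: (ge_inf (fset_has_lbound 0)); split => //.
rewrite (_ : (fun _ => _) = cst 0); first by rewrite log_integral0 lee_fin ltW.
by apply/funext => t; rewrite /cabs normc0 mul0r.
Qed.

Lemma log_fnorm_eq0 f : Lplus_pred f -> log_fnorm f = 0 ->
  {ae mu, forall t, D t -> f t = 0}.
Proof.
move=> Lf f0; have [mf _] := Lf.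
suff /log_integral_eq0 : log_integral p (cabs f) = 0%E.
  move=> /(_ (measurable_cabs mf) (cabs_ge0 f)).
  by apply: filterS => t /[apply]; exact: eq0_normc.
apply/eqP; rewrite eq_le log_integral_ge0 andbT.
apply/lee_addgt0Pr => e e0; rewrite add0e.
have m0 : 0 < Num.min 1 e by rewrite lt_min ltr01.
have [|r [r0 Ir]] := @inf_adherent _ (fset f) _ m0.
  by split; [exact: fset_nonempty|].
rewrite infE f0 add0r lt_min => /andP[r1 re].
apply: (@le_trans _ _ r%:E); last by rewrite lee_fin ltW.
apply: le_trans Ir; apply: le_log_integral.
- exact: measurable_cabs.
- exact: measurable_cabsV.
- exact: cabs_ge0.
- by move=> t; rewrite ler_pdivlMr// ler_piMr ?cabs_ge0// ltW.
Qed.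

Lemma log_fnormD f g : Lplus_pred f -> Lplus_pred g ->
  log_fnorm (f + g) <= log_fnorm f + log_fnorm g.
Proof.
move=> Lf Lg; have Lfg := Lplus_predD Lf Lg.
have [[mf _] [mg _] [mfg _]] := And3 Lf Lg Lfg.
suff H (a b : R) : fset f a -> fset g b -> log_fnorm (f + g) <= a + b.
  rewrite -lerBlDr -(infE f); apply: lb_le_inf; first exact: fset_nonempty.
  move=> a fa; rewrite lerBlDr -lerBlDl -(infE g).
  apply: lb_le_inf; first exact: fset_nonempty.
  by move=> b gb; rewrite lerBlDl H.
move=> [a0 fa] [b0 gb]; rewrite log_fnorm.unlock; apply: (ge_inf (fset_has_lbound _)).
have ab0 : 0 < a + b by rewrite addr_gt0.
split => //; rewrite EFinD; apply: le_trans (leeD fa gb).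
rewrite log_integral.unlock.
rewrite -ge0_integralD//; last 4 first.
- by move=> t _; rewrite lee_fin powR_ge0.
- by apply: measurable_log_pow; exact: measurable_cabsV.
- by move=> t _; rewrite lee_fin powR_ge0.
- by apply: measurable_log_pow; exact: measurable_cabsV.
apply: ge0_le_integral => //.
- by move=> t _; rewrite lee_fin powR_ge0.
- by apply: measurable_log_pow; exact: measurable_cabsV.
- by apply: emeasurable_funD; apply: measurable_log_pow; exact: measurable_cabsV.
- move=> t _; rewrite lee_fin.
  have ln0 (h : T -> R[i]) (e : R) : 0 < e -> 0 <= ln (1 + cabs h t / e).
    move=> e0; apply: ln1D_ge0; apply: divr_ge0; [exact: cabs_ge0|exact: ltW].
  have mono (h : T -> R[i]) (e : R) : 0 < e -> cabs (f + g) t / (a + b) <= cabs h t / e ->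
    ln (1 + cabs (f + g) t / (a + b)) `^ p <= ln (1 + cabs h t / e) `^ p.
    move=> e0 le; rewrite ge0_ler_powR ?nnegrE ?(ltW p0) ?ln0//.
    by rewrite ler_ln1D// divr_ge0 ?cabs_ge0// ltW.
  have [le|/ltW le] := leP (cabs f t / a) (cabs g t / b).
  + rewrite (le_trans (mono g b b0 _)) ?lerDr ?powR_ge0//.
    rewrite ler_pdivrMr// (le_trans (cabsD f g t))// mulrDr lerD//.
      by rewrite -ler_pdivrMr.
    by rewrite divfK ?gt_eqF.
  + rewrite (le_trans (mono f a a0 _)) ?lerDl ?powR_ge0//.
    rewrite ler_pdivrMr// (le_trans (cabsD f g t))// mulrDr lerD//.
      by rewrite divfK ?gt_eqF.
    by rewrite -ler_pdivrMr.
Qed.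

End log_integral.

Section Lplus.
Context d (T : measurableType d) (R : realType).
Variables (mu : {measure set T -> \bar R}) (D : set T).
Hypothesis mD : measurable D.
Variable p : {posnum R}.

(* The unused argument only makes the closure instances below inferable. *)
Definition Lplus_mem (_ : measurable D) : {pred T -> R[i]} :=
  fun f => `[< Lplus_pred mu D p%:num f >].

Let Lplus_memP f : reflect (Lplus_pred mu D p%:num f) (f \in Lplus_mem mD).
Proof. exact: asboolP. Qed.

Lemma Lplus_mem_zmod_closed : zmod_closed (Lplus_mem mD).
Proof.
split=> [|f g /Lplus_memP Lf /Lplus_memP Lg]; apply/Lplus_memP.
  exact: Lplus_pred0.
by apply: Lplus_predD => //; exact: Lplus_predN.
Qed.

HB.instance Definition _ :=
  GRing.isZmodClosed.Build _ (Lplus_mem mD) Lplus_mem_zmod_closed.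

(* A function on [D] is represented by a function on [T]; its values outside
   of [D] are irrelevant, since the quotient [Lplus] below identifies functions
   that agree almost everywhere on [D]. *)
Record Lplus_fun :=
  MkLplusFun { Lplus_val :> T -> R[i]; _ : Lplus_val \in Lplus_mem mD }.

HB.instance Definition _ := [isSub for Lplus_val].
HB.instance Definition _ := [Choice of Lplus_fun by <:].
HB.instance Definition _ := [SubChoice_isSubZmodule of Lplus_fun by <:].

Lemma Lplus_funP (f : Lplus_fun) : Lplus_pred mu D p%:num f.
Proof. by case: f => f Lf; exact/Lplus_memP. Qed.

Definition ae_zero : {pred Lplus_fun} :=
  fun f => `[< {ae mu, forall t, D t -> f t = 0} >].

Lemma ae_zero_zmod_closed : zmod_closed ae_zero.
Proof.
split=> [|f g /asboolP f0 /asboolP g0]; apply/asboolP.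
  exact: aeW.
apply: filterS2 f0 g0 => t f0 g0 Dt.
by rewrite [LHS](_ : _ = f t - g t)// f0// g0// subrr.
Qed.

HB.instance Definition _ := GRing.isZmodClosed.Build _ ae_zero ae_zero_zmod_closed.

Definition Lplus : Type := {ideal_quot ae_zero}.
HB.instance Definition _ := Choice.on Lplus.
HB.instance Definition _ := EqQuotient.on Lplus.
HB.instance Definition _ := GRing.Zmodule.on Lplus.

Lemma Lplus_eqP (f g : Lplus_fun) :
  \pi_Lplus f = \pi_Lplus g <-> {ae mu, forall t, D t -> f t = g t}.
Proof.
have E : (f == g %[mod Lplus]) = ((f - g) \in ae_zero).
  by rewrite Quotient.idealrBE.
split=> [/eqP|fg].
  rewrite E => /asboolP; apply: filterS => t fg Dt.
  by apply/eqP; rewrite -subr_eq0; apply/eqP/fg.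
apply/eqP; rewrite E; apply/asboolP; apply: filterS fg => t fg Dt.
by rewrite [LHS](_ : _ = f t - g t)// fg// subrr.
Qed.

Lemma Lplus_piD (f g : Lplus_fun) :
  \pi_Lplus f + \pi_Lplus g = \pi_Lplus (f + g).
Proof. exact/esym/Quotient.pi_add. Qed.

Lemma Lplus_piN (f : Lplus_fun) : - \pi_Lplus f = \pi_Lplus (- f).
Proof. exact/esym/Quotient.pi_opp. Qed.

Lemma Lplus_pi0 : \pi_Lplus 0 = 0.
Proof. by rewrite /0/= !piE. Qed.

Let cmeas (f : Lplus_fun) : cmeasurable D f.
Proof. by case: (Lplus_funP f). Qed.

(* Both functionals are independent of the representative: see [Lplus_norm_pi]
   and [Lplus_fnorm_pi]. *)
Definition Lplus_norm (f : Lplus) : R := log_norm mu D p%:num (repr f).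

Definition Lplus_fnorm (f : Lplus) : R := log_fnorm mu D p%:num (repr f).

Lemma Lplus_norm_pi (f : Lplus_fun) :
  Lplus_norm (\pi_Lplus f) = log_norm mu D p%:num f.
Proof.
apply: ae_log_norm => //; apply/Lplus_eqP; exact: reprK.
Qed.

Lemma Lplus_fnorm_pi (f : Lplus_fun) :
  Lplus_fnorm (\pi_Lplus f) = log_fnorm mu D p%:num f.
Proof.
apply: ae_log_fnorm => //; apply/Lplus_eqP; exact: reprK.
Qed.

Definition Lplus_rho (f g : Lplus) : R :=
  Lplus_norm (f - g) `^ Num.min p%:num 1.

Definition Lplus_fdist (f g : Lplus) : R := Lplus_fnorm (f - g).

Lemma Lplus_norm0 : Lplus_norm 0 = 0.
Proof. by rewrite -Lplus_pi0 Lplus_norm_pi log_norm0. Qed.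

Lemma Lplus_normN f : Lplus_norm (- f) = Lplus_norm f.
Proof.
elim/quotW: f => f; rewrite Lplus_piN !Lplus_norm_pi.
exact: (log_normN _ _ _ (f : T -> R[i])).
Qed.

Lemma Lplus_norm_eq0 f : Lplus_norm f = 0 -> f = 0.
Proof.
elim/quotW: f => f; rewrite Lplus_norm_pi -Lplus_pi0 => f0.
by apply/Lplus_eqP; exact: log_norm_eq0 (Lplus_funP f) f0.
Qed.

Lemma Lplus_fnorm0 : Lplus_fnorm 0 = 0.
Proof. by rewrite -Lplus_pi0 Lplus_fnorm_pi log_fnorm0. Qed.

Lemma Lplus_fnormN f : Lplus_fnorm (- f) = Lplus_fnorm f.
Proof.
elim/quotW: f => f; rewrite Lplus_piN !Lplus_fnorm_pi.
exact: (log_fnormN _ _ _ (f : T -> R[i])).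
Qed.

Lemma Lplus_fnormD f g : Lplus_fnorm (f + g) <= Lplus_fnorm f + Lplus_fnorm g.
Proof.
elim/quotW: f => f; elim/quotW: g => g; rewrite Lplus_piD !Lplus_fnorm_pi.
exact: log_fnormD (Lplus_funP f) (Lplus_funP g).
Qed.

Lemma Lplus_fnorm_eq0 f : Lplus_fnorm f = 0 -> f = 0.
Proof.
elim/quotW: f => f; rewrite Lplus_fnorm_pi -Lplus_pi0 => f0.
by apply/Lplus_eqP; exact: log_fnorm_eq0 (Lplus_funP f) f0.
Qed.

Lemma Lplus_rhoxx f : Lplus_rho f f = 0.
Proof.
by rewrite /Lplus_rho subrr Lplus_norm0 powR0.
Qed.

Lemma Lplus_rho_positivity f g : Lplus_rho f g = 0 -> f = g.
Proof. by move/powR_eq0_eq0/Lplus_norm_eq0/subr0_eq. Qed.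

Lemma Lplus_rho_sym f g : Lplus_rho f g = Lplus_rho g f.
Proof. by rewrite /Lplus_rho -Lplus_normN opprB. Qed.

Lemma Lplus_rho_triangle g f h :
  Lplus_rho f h <= Lplus_rho f g + Lplus_rho g h.
Proof.
rewrite /Lplus_rho -(subrKA g f).
move: (f - g) (g - h) => {}f {}g.
elim/quotW: f => f; elim/quotW: g => g; rewrite Lplus_piD !Lplus_norm_pi.
exact: log_normD (Lplus_funP f) (Lplus_funP g).
Qed.

Lemma Lplus_fdistxx f : Lplus_fdist f f = 0.
Proof. by rewrite /Lplus_fdist subrr Lplus_fnorm0. Qed.

Lemma Lplus_fdist_positivity f g : Lplus_fdist f g = 0 -> f = g.
Proof. by move/Lplus_fnorm_eq0/subr0_eq. Qed.

Lemma Lplus_fdist_sym f g : Lplus_fdist f g = Lplus_fdist g f.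
Proof. by rewrite /Lplus_fdist -Lplus_fnormN opprB. Qed.

Lemma Lplus_fdist_triangle g f h :
  Lplus_fdist f h <= Lplus_fdist f g + Lplus_fdist g h.
Proof. by rewrite /Lplus_fdist -(subrKA g f); exact: Lplus_fnormD. Qed.

(* Two aliases of [Lplus], each carrying the topology of one metric. *)
Definition Lplus_modular : Type := Lplus.
HB.instance Definition _ := Choice.on Lplus_modular.
HB.instance Definition _ := isMetric.Build R Lplus_modular
  Lplus_rhoxx Lplus_rho_positivity Lplus_rho_sym Lplus_rho_triangle.

Definition Lplus_fnormed : Type := Lplus.
HB.instance Definition _ := Choice.on Lplus_fnormed.
HB.instance Definition _ := isMetric.Build R Lplus_fnormed
  Lplus_fdistxx Lplus_fdist_positivity Lplus_fdist_sym Lplus_fdist_triangle.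

Lemma open_metricE (M : metricType R) (U : set M) :
  open U <-> forall f, U f -> exists2 e : R, 0 < e & forall g, mdist f g < e -> U g.
Proof.
rewrite openE; split=> [oU f /oU /nbhs_ballP[e/= e0 eU]|oU f /oU[e e0 eU]].
  by exists e => // g fg; apply: eU; rewrite ballEmdist.
by apply/nbhs_ballP; exists e => //= g; rewrite ballEmdist; exact: eU.
Qed.

Lemma open_modularE (U : set Lplus) : @open Lplus_modular U <->
  forall f, U f -> exists2 e : R, 0 < e & forall g, Lplus_rho f g < e -> U g.
Proof. exact: (@open_metricE Lplus_modular). Qed.

Lemma open_fnormedE (U : set Lplus) : @open Lplus_fnormed U <->
  forall f, U f -> exists2 e : R, 0 < e & forall g, Lplus_fdist f g < e -> U g.
Proof. exact: (@open_metricE Lplus_fnormed). Qed.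

End Lplus.

Section Lp.
Variable R : realType.

Lemma inv2pi_ge0 : 0 <= (2 * trigo.pi : R)^-1.
Proof. by rewrite invr_ge0 mulr_ge0// pi_ge0. Qed.

(* The measure dt / 2pi on the sigma-algebra of all Lebesgue measurable sets
   (the plain [lebesgue_measure] only lives on the Borel sets). *)
Definition dt2pi := mscale (NngNum inv2pi_ge0) (@completed_lebesgue_measure R).

Definition period : set R := `[0, 2 * trigo.pi[.

Lemma measurable_period :
  measurable (period : set (caratheodory_type (@wlength R idfun)^*%mu)).
Proof. by apply: sub_caratheodory; exact: measurable_itv. Qed.

Variable p : {posnum R}.

Definition Lp := Lplus dt2pi measurable_period p.

Definition Lp_modular := Lplus_modular dt2pi measurable_period p.

Definition Lp_fnormed := Lplus_fnormed dt2pi measurable_period p.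

End Lp.

(* Main.v *)
Require Import Defs.
From mathcomp Require Import all_boot all_order all_algebra.
From mathcomp Require Import all_classical all_reals all_analysis.
From mathcomp Require Import measurable_realfun.

Import Order.TTheory GRing.Theory Num.Theory numFieldNormedType.Exports.

Local Open Scope classical_set_scope.
Local Open Scope ring_scope.

(** The modular of [f] is at most that of [f / r] when [r <= 1], so a small
    F-norm forces a small modular norm.  Conversely, for fixed [e > 0] and
    [c > 0] one has [ln (1 + x / e) `^ p <= c + C * ln (1 + x) `^ p] for all
    [x >= 0]: below the threshold [x = e * c `^ p^-1] the left-hand side is at
    most [c], and above it [ln (1 + x / e)] is comparable to [ln (1 + x)].
    Integrating over a set of finite measure, the modular of [f / e] is small
    as soon as the modular of [f] is.  Both comparisons are uniform in [f] and
    both distances depend only on [f - g], so the two topologies and the two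
    notions of convergence agree. *)

Lemma powR_ln1D_div_le (R : realType) (p c e : R) : 0 < p -> 0 < c -> 0 < e ->
  exists2 C : R, 0 < C &
    forall x : R, 0 <= x -> ln (1 + x / e) `^ p <= c + C * ln (1 + x) `^ p.
Proof.
move=> p0 c0 e0; pose q := c `^ p^-1; pose L := ln (1 + e * q).
have q0 : 0 < q by rewrite powR_gt0.
have L0 : 0 < L by rewrite ln_gt0// ltrDl mulr_gt0.
have A0 : 0 <= ln (1 + e^-1) by rewrite ln1D_ge0// invr_ge0 ltW.
have K0 : 0 < 1 + ln (1 + e^-1) / L by rewrite ltr_pwDl// divr_ge0// ltW.
(* Above the threshold [e * q], [L <= ln (1 + x)], so the excess [ln (1 + e^-1)] in [ln (1 + x / e)
   <= ln (1 + x) + ln (1 + e^-1)] is at most [ln (1 + e^-1) / L] times [ln (1 + x)]. *)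
exists ((1 + ln (1 + e^-1) / L) `^ p); first by rewrite powR_gt0.
move=> x x0; have xe0 : 0 <= x / e by rewrite divr_ge0// ltW.
have l0 := ln1D_ge0 x0.
have [xs|/ltW xb] := leP x (e * q).
  apply: (@le_trans _ _ c); last by rewrite lerDl mulr_ge0// powR_ge0.
  rewrite [leRHS](_ : _ = q `^ p); last first.
    by rewrite -powRrM mulVf ?gt_eqF// powRr1// ltW.
  rewrite ge0_ler_powR ?nnegrE ?(ltW p0) ?(ltW q0) ?ln1D_ge0//.
  apply: (@le_trans _ _ (x / e)); last by rewrite ler_pdivrMr// mulrC.
  by rewrite le_ln1Dx// (lt_le_trans _ xe0).
apply: ler_wpDl; first exact: ltW.
rewrite -powRM ?(ltW K0)// ge0_ler_powR ?nnegrE ?(ltW p0) ?ln1D_ge0//.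
  by rewrite mulr_ge0// ltW.
(* Expanding the product gives [1 + x / e <= (1 + x) * (1 + e^-1)]. *)
apply: (@le_trans _ _ (ln (1 + x) + ln (1 + e^-1))).
  have x1 : 0 < 1 + x by rewrite ltr_pwDl.
  have e1 : 0 < 1 + e^-1 by rewrite ltr_pwDl// invr_ge0 ltW.
  rewrite -lnM ?posrE// ler_ln ?posrE ?mulr_gt0//; last exact: ltr_pwDl.
  by rewrite mulrDl mul1r mulrDr mulr1 -addrA lerD2l addrA lerDr
    addr_ge0// invr_ge0 ltW.
rewrite mulrDl mul1r lerD2l mulrAC ler_pdivlMr// ler_wpM2l//.
by rewrite ler_ln1D// mulr_ge0 ?ltW.
Qed.

Section functionals.
Context {d} {T : measurableType d} {R : realType}.
Variables (mu : {measure set T -> \bar R}) (D : set T).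
Hypothesis mD : measurable D.
Variable p : R.
Hypothesis p0 : 0 < p.

Lemma log_integral_div_small : (mu D < +oo)%E ->
  forall c e : R, 0 < c -> 0 < e -> exists2 r : R, 0 < r &
    forall a : T -> R, measurable_fun D a -> (forall t, 0 <= a t) ->
    (log_integral mu D p a < r%:E)%E ->
    (log_integral mu D p (fun t => (a t / e)%R) <= c%:E)%E.
Proof.
move=> Dfin c e c0 e0; pose m := fine (mu D).
have muE : mu D = m%:E by rewrite fineK// ge0_fin_numE.
have m0 : 0 <= m by rewrite fine_ge0.
have m1 : 0 < m + 1 by rewrite ltr_wpDl.
have c20 : 0 < c / 2 by rewrite divr_gt0.
(* Half of [c] pays for the constant term integrated over [D]; dividing by [m + 1] instead of [m]
   covers a null [D]. The other half is [C] times the radius [c / 2 / C]. *)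
have cm0 : 0 < c / 2 / (m + 1) by rewrite divr_gt0.
have [C C0 H] := @powR_ln1D_div_le _ p _ _ p0 cm0 e0.
exists (c / 2 / C); first by rewrite divr_gt0.
move=> a ma a0; rewrite log_integral.unlock => Ia.
have mpow (b : T -> R) : measurable_fun D b ->
    measurable_fun D (fun t => (ln (1 + b t) `^ p)%:E).
  exact: measurable_log_pow.
apply: (@le_trans _ _ (\int[mu]_(t in D)
    ((c / 2 / (m + 1))%:E + C%:E * (ln (1 + a t) `^ p)%:E))%E).
  apply: ge0_le_integral => //.
  - by move=> t _; rewrite lee_fin powR_ge0.
  - by apply: mpow; exact: measurable_funM.
  - apply: emeasurable_funD; first exact: measurable_cst.
    by apply: emeasurable_funM; [exact: measurable_cst|exact: mpow].
  - by move=> t _; rewrite -EFinM -EFinD lee_fin H.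
rewrite ge0_integralD//; last 3 first.
- by move=> t _; rewrite lee_fin ltW.
- by move=> t _; rewrite -EFinM lee_fin mulr_ge0 ?powR_ge0// ltW.
- by apply: emeasurable_funM; [exact: measurable_cst|exact: mpow].
rewrite integral_cst// muE ge0_integralZl_EFin ?(ltW C0)//; last 2 first.
- by move=> t _; rewrite lee_fin powR_ge0.
- exact: mpow.
rewrite [c in leRHS]splitr EFinD leeD//.
  by rewrite -EFinM lee_fin mulrAC ler_pdivrMr// ler_wpM2l ?(ltW c20)// lerDl.
rewrite [leRHS](_ : _ = (C%:E * (c / 2 / C)%:E)%E); last first.
  by rewrite -EFinM [C * _]mulrC divfK// gt_eqF.
by apply: lee_wpmul2l; [rewrite lee_fin ltW|exact: ltW].
Qed.

Lemma log_fnorm_small : (mu D < +oo)%E -> forall e : R, 0 < e ->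
  exists2 r : R, 0 < r & forall f, Lplus_pred mu D p f ->
    log_norm mu D p f < r -> log_fnorm mu D p f < e.
Proof.
(* Showing that [e / 2] belongs to the set defining the F-norm bounds the infimum by [e / 2], which
   gives the strict inequality. *)
move=> Dfin e e0; have e20 : 0 < e / 2 by rewrite divr_gt0.
have [r r0 H] := log_integral_div_small Dfin _ _ e20 e20.
exists (r `^ p^-1); first by rewrite powR_gt0.
move=> f Lf fr; have [mf _] := Lf.
apply: (@le_lt_trans _ _ (e / 2)); last by rewrite ltr_pdivrMr// ltr_pMr// ltr1n.
rewrite log_fnorm.unlock; apply: ge_inf.
  by exists 0 => s [/ltW].
split=> //; apply: H.
- exact: measurable_cabs.
- exact: cabs_ge0.
- rewrite -(Lplus_fin Lf)// lte_fin -(log_normX p0 Lf).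
  rewrite [ltRHS](_ : _ = (r `^ p^-1) `^ p); last first.
    by rewrite -powRrM mulVf ?gt_eqF// powRr1// ltW.
  by rewrite gt0_ltr_powR ?nnegrE ?powR_ge0 ?log_norm_ge0.
Qed.

Lemma le_log_integral_div (f : T -> complex.complex R) (e : R) :
  cmeasurable D f -> 0 < e -> e <= 1 ->
  (log_integral mu D p (cabs f) <= log_integral mu D p (fun t => (cabs f t / e)%R))%E.
Proof.
move=> mf e0 e1; apply: le_log_integral => //.
- exact: measurable_cabs.
- by apply: measurable_funM => //; exact: measurable_cabs.
- exact: cabs_ge0.
- by move=> t; rewrite ler_pdivlMr// ler_piMr// cabs_ge0.
Qed.

Lemma log_norm_small (e : R) : 0 < e ->
  exists2 r : R, 0 < r & forall f, Lplus_pred mu D p f ->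
    log_fnorm mu D p f < r -> log_norm mu D p f < e.
Proof.
(* The bound [1] yields an admissible scale [r <= 1], for which dividing by [r] only enlarges the
   modular; the bound [e ^ p] then controls the modular, which is the [p]-th power of the norm. *)
move=> e0; exists (Num.min 1 (e `^ p)); first by rewrite lt_min ltr01 powR_gt0.
move=> f Lf; have [mf _] := Lf; rewrite log_fnorm.unlock => /inf_lt[].
  (* [inf set0 = 0], so nonemptiness has to be checked. *)
  pose s := Num.max 1 (fine (log_integral mu D p (cabs f))).
  have s1 : 1 <= s by rewrite le_max lexx.
  have s0 : 0 < s := lt_le_trans ltr01 s1.
  (* Dividing by [s >= 1] does not increase the modular, and the modular of [f] is at most [s]. *)
  exists s; split=> //; apply: (@le_trans _ _ (log_integral mu D p (cabs f))).
    apply: le_log_integral => //.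
    - by apply: measurable_funM => //; exact: measurable_cabs.
    - exact: measurable_cabs.
    - by move=> t; rewrite divr_ge0 ?cabs_ge0// ltW.
    - by move=> t; rewrite ler_pdivrMr// ler_peMr// cabs_ge0.
  by rewrite -(Lplus_fin Lf) lee_fin le_max lexx orbT.
move=> r [r0 Ir]; rewrite lt_min => /andP[/ltW r1 re].
have := le_trans (le_log_integral_div _ _ mf r0 r1) Ir.
rewrite -(Lplus_fin Lf) lee_fin -(log_normX p0 Lf) => fr.
have [//|ef] := ltP (log_norm mu D p f) e.
suff : e `^ p <= log_norm mu D p f `^ p by rewrite leNgt (le_lt_trans fr re).
by rewrite ge0_ler_powR ?nnegrE ?log_norm_ge0 ?(ltW p0)// ltW.
Qed.

End functionals.

Section quotient.
Context {d} {T : measurableType d} {R : realType}.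
Variables (mu : {measure set T -> \bar R}) (D : set T) (mD : measurable D).
Variable p : {posnum R}.
Local Notation Lplus := (Lplus mu mD p).

(** Both functionals on the quotient are evaluated at [repr f], so the estimate for functions
    applies directly to that representative. *)
Lemma Lplus_fnorm_small : (mu D < +oo)%E -> forall e : R, 0 < e ->
  exists2 r : R, 0 < r & forall f : Lplus, Lplus_norm f < r -> Lplus_fnorm f < e.
Proof.
move=> Dfin e e0.
have [r r0 H] := @log_fnorm_small _ _ _ mu D mD p%:num (gt0 p) Dfin e e0.
by exists r => // f; apply: H; exact: Lplus_funP.
Qed.

Lemma Lplus_norm_small (e : R) : 0 < e ->
  exists2 r : R, 0 < r & forall f : Lplus, Lplus_fnorm f < r -> Lplus_norm f < e.
Proof.
move=> e0; have [r r0 H] := @log_norm_small _ _ _ mu D mD p%:num (gt0 p) e e0.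
by exists r => // f; apply: H; exact: Lplus_funP.
Qed.

Lemma Lplus_norm_ge0 (f : Lplus) : 0 <= Lplus_norm f.
Proof. exact: log_norm_ge0. Qed.

Lemma Lplus_fnorm_ge0 (f : Lplus) : 0 <= Lplus_fnorm f.
Proof. by apply: log_fnorm_ge0 => //; exact: Lplus_funP. Qed.

(** The exponent is positive, so the power is strictly increasing on nonnegative reals. This turns
    balls of [Lplus_rho] into conditions on [Lplus_norm]. *)
Lemma Lplus_rho_lt (e : R) (f g : Lplus) : 0 < e ->
  (Lplus_rho f g < e `^ Num.min p%:num 1) = (Lplus_norm (f - g) < e).
Proof.
move=> e0; have m0 : 0 < Num.min p%:num 1 :> R by rewrite lt_min gt0 ltr01.
apply/idP/idP; last first.
  by apply: gt0_ltr_powR; rewrite ?nnegrE ?Lplus_norm_ge0// ltW.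
apply: contraTT; rewrite -!leNgt => h.
by rewrite ge0_ler_powR ?nnegrE ?Lplus_norm_ge0// ltW.
Qed.

Lemma open_modular_fnormed : (mu D < +oo)%E -> forall U : set Lplus,
  @open (Lplus_modular mu mD p) U <-> @open (Lplus_fnormed mu mD p) U.
Proof.
move=> Dfin U; have m0 : Num.min p%:num 1 != 0 :> R.
  by rewrite gt_eqF// lt_min gt0 ltr01.
split=> [/open_modularE oU|/open_fnormedE oU].
  apply/open_fnormedE => f /oU[e e0 eU].
  (* A norm below this root of [e] is the same as a [Lplus_rho] distance below [e]. *)
  have e'0 : 0 < e `^ (Num.min p%:num 1)^-1 by rewrite powR_gt0.
  have [r r0 H] := Lplus_norm_small _ e'0.
  exists r => // g /H; rewrite -Lplus_rho_lt// -powRrM mulVf// powRr1 ?ltW//.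
  exact: eU.
apply/open_modularE => f /oU[e e0 eU].
have [r r0 H] := Lplus_fnorm_small Dfin _ e0.
exists (r `^ Num.min p%:num 1); first by rewrite powR_gt0.
by move=> g; rewrite Lplus_rho_lt// => /H; exact: eU.
Qed.

End quotient.

(** Stated for abstract functionals so that it serves both directions of the convergence claim, with
    the differences [u n - f] as the sequence. *)
Lemma cvg0_comp (V : Type) (R : realType) (N1 N2 : V -> R) (u : nat -> V) :
  (forall h, 0 <= N1 h) -> (forall h, 0 <= N2 h) ->
  (forall e, 0 < e -> exists2 r, 0 < r & forall h, N1 h < r -> N2 h < e) ->
  (fun n => N1 (u n)) @ \oo --> (0 : R) -> (fun n => N2 (u n)) @ \oo --> (0 : R).
Proof.
move=> N10 N20 H /cvgr0Pnorm_lt u1; apply/cvgr0Pnorm_lt => e e0.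
have [r r0 {}H] := H _ e0.
by apply: filterS (u1 _ r0) => n; rewrite !ger0_norm//; exact: H.
Qed.

Lemma dt2pi_period_fin (R : realType) : (dt2pi (@period R) < +oo)%E.
Proof.
rewrite /dt2pi /mscale/= lte_mul_pinfty// ?lee_fin ?inv2pi_ge0//.
(* The completed measure has the same value here by conversion, which makes the formula for the
   length of an interval available. *)
rewrite [ltLHS](_ : _ = lebesgue_measure (@period R))//.
by rewrite /period lebesgue_measure_itv/=; case: ifP => _; rewrite ?ltry// -EFinB ltry.
Qed.

Theorem theorem4p1 (R : realType) (p : {posnum R}) :
  (forall U : set (Lp p), @open (Lp_modular p) U <-> @open (Lp_fnormed p) U)
  /\
  (forall (u : nat -> Lp p) (f : Lp p),
    (fun n => Lplus_fnorm (u n - f)) @ \oo --> (0 : R) <->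
    (fun n => Lplus_norm (u n - f)) @ \oo --> (0 : R)).
Proof.
have fin := dt2pi_period_fin R; split; first exact: open_modular_fnormed.
move=> u f; split; apply: (@cvg0_comp _ _ _ _ (fun n => u n - f)).
- exact: Lplus_fnorm_ge0.
- exact: Lplus_norm_ge0.
- exact: Lplus_norm_small.
- exact: Lplus_norm_ge0.
- exact: Lplus_fnorm_ge0.
- exact: Lplus_fnorm_small.
Qed.
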